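(* Let $(X,\leq)$ be a poset of bountiful structures under the consecutive order, that is, $X$ is the set of all structures of some bountiful type and $\leq$ is the consecutive order. Then the well quasi-order problem is decidable for $(X,\leq)$: it is decidable, given a finite set $B\subseteq X$, whether $\mathrm{Av}(B)$ is well quasi-ordered under the consecutive order.
   Context: Conventions: $\mathbb{N}=\{1,2,3,\dots\}$ and $[m,n]=\{m,m+1,\dots,n\}$. Structures. A structure is a pair $(X,R)$ with $X$ a finite subset of $\mathbb{N}$ and $R$ a sequence of relations on $X$, the first of which is the linear order on $X$ inherited from $\mathbb{N}$. The sequence of arities of the relations in $R$ is the signature. Structures are of the same type if they have the same signature and, perhaps, satisfy certain additional conditions. Two structures of the same type are isomorphic ($\cong$) if relabelling the points of each in increasing order by $1,2,\dots$ gives exactly the same structure; isomorphic structures are considered equal, so every structure may be taken to have underlying set $[1,n]$ for some $n\in\mathbb{N}$. The length of $(X,R)$ is $|(X,R)|=|X|$. For $Y\subseteq X$, $\sigma\upharpoonright_Y$ is the restriction of $\sigma$ to the points in $Y$. Consecutive order: for $\sigma,\rho$ of the same type, $\sigma\leq\rho$ iff $\sigma\cong\rho\upharpoonright_{[k,k+|\sigma|-1]}$ for some $k\ge 1$ with $k+|\sigma|-1\le|\rho|$. Valid types. Let $\sigma,\rho$ be structures of the same type with $|\sigma|=p$, $|\rho|=q$. They overlap (on $x$ points) if $\sigma\upharpoonright_{[p-x+1,p]}\cong\rho\upharpoonright_{[1,x]}$ for some $x\geq 1$. A structure $\theta$ of the same type with $|\theta|=p+q-x$ combines them if $\theta\upharpoonright_{[1,p]}\cong\sigma$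 and $\theta\upharpoonright_{[p-x+1,p+q-x]}\cong\rho$. A type is valid if for any two overlapping structures of this type there is a structure of the same type which combines them. Bountiful types. A valid type is bountiful if for any structures $\sigma,\rho$ of this type with $|\sigma|=|\rho|=m$ for some $m\in\mathbb{N}$ and $\sigma\upharpoonright_{[2,m]}\cong\rho\upharpoonright_{[1,m-1]}$ (for $m=1$ both are restrictions to the empty set), there exist at least two structures $\theta_1,\theta_2$ of the same type and of length $m+1$ with $\theta_i\upharpoonright_{[1,m]}\cong\sigma$ and $\theta_i\upharpoonright_{[2,m+1]}\cong\rho$ for $i=1,2$. Avoidance sets: $\mathrm{Av}(B)=\{x\in X: \beta\nleq x \text{ for all } \beta\in B\}$. A poset is well quasi-ordered if it contains neither infinite antichains nor infinite descending sequences.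
   Formalization: Membership in the bountiful type X is assumed decidable (the claim fails for some bountiful types with undecidable membership), and the type is explicitly assumed to consist of nonempty structures and to be closed under restriction to nonempty intervals. *)

(* Defs.v *)
From mathcomp Require Import all_boot.

Set Implicit Arguments.
Unset Strict Implicit.
Unset Printing Implicit Defensive.

(* Structures are taken up to isomorphism, on the points 0, ..., n - 1 instead *)
(* of 1, ..., n, so that isomorphism is equality.  The first relation, the     *)
(* linear order inherited from the natural numbers, is that of 'I_n and is     *)
(* left implicit: s lists the arities of the relations that come after it.     *)
Definition relations (s : seq nat) (n : nat) :=
  {dffun forall i : 'I_(size s), {set (nth 0 s i).-tuple 'I_n}}.

(* The structure on no points belongs to this type: it is the restriction of a *)
(* one-point structure to the empty set.  It is excluded by structure_type.    *)
Definition structure (s : seq nat) := {n : nat & relations s n}.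

Definition len s (sigma : structure s) : nat := tag sigma.

Definition rels s (sigma : structure s) (i : 'I_(size s)) :
  {set (nth 0 s i).-tuple 'I_(len sigma)} := tagged sigma i.

(* The restriction of sigma to the l points k, ..., k + l - 1, relabelled by   *)
(* 0, ..., l - 1.  Only meaningful when k + l <= len sigma.                    *)
Definition restrict s (k l : nat) (sigma : structure s) : structure s :=
  Tagged (relations s)
    ([ffun i : 'I_(size s) => [set t : (nth 0 s i).-tuple 'I_l |
       [exists u in rels sigma i, map val u == [seq k + val x | x <- t]]]]
     : relations s l).

Definition cons_le s (sigma rho : structure s) : Prop :=
  exists k, k + len sigma <= len rho /\ sigma = restrict k (len sigma) rho.

(* Closure under isomorphism is automatic.  Restrictions of a structure of a   *)
(* type to nonempty intervals are again structures of that type.               *)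
Record structure_type s (X : structure s -> Prop) : Prop := StructureType {
  type_nonempty : forall sigma, X sigma -> 0 < len sigma;
  type_restrict : forall sigma k l,
    X sigma -> 0 < l -> k + l <= len sigma -> X (restrict k l sigma)
}.

Definition overlap s (x : nat) (sigma rho : structure s) : Prop :=
  [/\ 1 <= x, x <= len sigma, x <= len rho &
      restrict (len sigma - x) x sigma = restrict 0 x rho].

Definition combines s (x : nat) (sigma rho theta : structure s) : Prop :=
  [/\ len theta = len sigma + len rho - x,
      restrict 0 (len sigma) theta = sigma &
      restrict (len sigma - x) (len rho) theta = rho].

Definition valid s (X : structure s -> Prop) : Prop :=
  forall sigma rho x, X sigma -> X rho -> overlap x sigma rho ->
  exists2 theta, X theta & combines x sigma rho theta.

Definition bountiful s (X : structure s -> Prop) : Prop :=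
  valid X /\
  forall m sigma rho, X sigma -> X rho -> len sigma = m -> len rho = m ->
  restrict 1 m.-1 sigma = restrict 0 m.-1 rho ->
  exists theta1 theta2, theta1 <> theta2 /\
    forall theta, theta = theta1 \/ theta = theta2 ->
    [/\ X theta, len theta = m.+1,
        restrict 0 m theta = sigma & restrict 1 m theta = rho].

Definition Av s (X : structure s -> Prop) (B : seq (structure s)) :
  structure s -> Prop :=
  fun sigma => X sigma /\ forall beta : structure s, beta \in B -> ~ cons_le beta sigma.

Definition infinite_antichain T (le : T -> T -> Prop) (A : T -> Prop) : Prop :=
  exists f : nat -> T, (forall i, A (f i)) /\
    forall i j, i <> j -> f i <> f j /\ ~ le (f i) (f j).

Definition infinite_descending T (le : T -> T -> Prop) (A : T -> Prop) : Prop :=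
  exists f : nat -> T, (forall i, A (f i)) /\
    forall i, le (f i.+1) (f i) /\ f i.+1 <> f i.

Definition wqo T (le : T -> T -> Prop) (A : T -> Prop) : Prop :=
  ~ infinite_antichain le A /\ ~ infinite_descending le A.

(* The total recursive functions, as the least class of functions containing   *)
(* the initial functions and closed under composition, primitive recursion and *)
(* minimisation of regular functions.                                          *)
Inductive recursive : forall k : nat, (k.-tuple nat -> nat) -> Prop :=
| rec_zero k : @recursive k (fun _ => 0)
| rec_succ : @recursive 1 (fun x => (tnth x ord0).+1)
| rec_proj k (i : 'I_k) : @recursive k (fun x => tnth x i)
| rec_comp k m (f : m.-tuple nat -> nat) (g : 'I_m -> k.-tuple nat -> nat) :
    recursive f -> (forall i, recursive (g i)) ->
    @recursive k (fun x => f [tuple g i x | i < m])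
| rec_prim k (f : k.-tuple nat -> nat) (g : k.+2.-tuple nat -> nat)
    (h : k.+1.-tuple nat -> nat) :
    recursive f -> recursive g ->
    (forall x : k.-tuple nat, h [tuple of 0 :: x] = f x) ->
    (forall n (x : k.-tuple nat), h [tuple of n.+1 :: x] =
       g [tuple of n :: h [tuple of n :: x] :: x]) ->
    recursive h
| rec_min k (f : k.+1.-tuple nat -> nat) (g : k.-tuple nat -> nat) :
    recursive f ->
    (forall x : k.-tuple nat, f [tuple of g x :: x] = 0) ->
    (forall (x : k.-tuple nat) n, n < g x -> f [tuple of n :: x] <> 0) ->
    recursive g.

(* The problem "given an instance x such that D x, does Q x hold?" is          *)
(* decidable, where instances are presented by their codes.                    *)
Definition decidable_problem I (code : I -> nat) (D Q : I -> Prop) : Prop :=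
  exists2 d : 1.-tuple nat -> nat, recursive d &
    forall x, D x -> (Q x <-> d [tuple code x] = 1).

(* A tuple of points is the number with these digits in base n, least          *)
(* significant first, and a set of tuples is the number with bit               *)
(* tuple_index t set exactly for the tuples t in the set.                      *)
Definition tuple_index n (t : seq 'I_n) : nat :=
  foldr (fun (x : 'I_n) a => x + n * a) 0 t.

Definition code_rel n r (R : {set r.-tuple 'I_n}) : nat :=
  \sum_(t in R) 2 ^ tuple_index t.

(* CodeSeq.code is an explicit bijection from seq nat to nat. *)
Definition code_structure s (sigma : structure s) : nat :=
  CodeSeq.code (len sigma ::
    [seq code_rel (rels sigma i) | i <- enum 'I_(size s)]).

Definition code_structures s (B : seq (structure s)) : nat :=
  CodeSeq.code (map (@code_structure s) B).

(* Main.v *)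
Require Import Defs.
From mathcomp Require Import all_boot.
From Stdlib Require Import FunctionalExtensionality IndefiniteDescription.

(** Let m be positive and at least the length of every member of B, and let K
    be the number of all structures of length m.  For a bountiful type, Av(B)
    is well quasi-ordered exactly when it contains no structure of length
    K + m, and the latter is a finite search ([bountiful_wqoP]).

    If Av(B) has no structure of that length then, being closed under
    restriction, it has only finitely many members, and a set in which lengths
    are bounded has no infinite antichain ([wqo_of_no_long]).

    If sigma in Av(B) has length K + m, then two of its K + 1 windows of length
    m, at positions p < q say, coincide ([repeated_window]).  Hence the windows
    of length m + 1 of sigma starting at p, ..., q - 1 can be repeated
    cyclically, consecutive ones overlapping in m points, and validity glues
    any such sequence into one structure ([glue_windows]).  Bountifulness
    offers two different structures theta1 and theta2 of length m + 1 for the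
    window at p.  Replace every occurrence of theta2 in the cyclic sequence by
    theta1, except that theta2 stands at the first and at the last place of a
    sequence that goes n times round the cycle.  The structures so obtained,
    n = 1, 2, ..., form an infinite antichain: an embedding has to match the
    two occurrences of theta2 ([antichain_of_long]).  They belong to Av(B)
    because all their windows of length m are windows of sigma.

    For decidability, with y the code of B, the number m = y + 1 bounds the
    lengths, K is computed from the arities, and the codes of all structures of
    length K + m are enumerated by bounded quantifiers, one for each relation
    ([search_structureP]).  Each candidate is tested for membership in X by the
    given procedure and for avoiding B by arithmetic on codes
    ([avoids_codeP]).  That all this is recursive follows from closure
    properties of the class of computable functions of an environment. *)

Set Implicit Arguments.
Unset Strict Implicit.
Unset Printing Implicit Defensive.

(** * Restrictions and lengths *)

Section Restriction.
Variable s : seq nat.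
Implicit Types sigma rho : structure s.

(** A relation read on sequences of natural numbers: this removes the dependency
    of tuples on arity and length, so that restrictions compose by plain
    arithmetic. *)
Definition holds sigma (i : 'I_(size s)) (v : seq nat) : bool :=
  [exists u in rels sigma i, map val u == v].

Lemma holds_map_val sigma (i : 'I_(size s))
    (t : (nth 0 s i).-tuple 'I_(len sigma)) :
  holds sigma i (map val t) = (t \in rels sigma i).
Proof.
apply/exists_inP/idP => [[u uR /eqP/(inj_map val_inj)/val_inj <-]|tR] //.
by exists t.
Qed.

Lemma holds_bounded sigma (i : 'I_(size s)) v : holds sigma i v ->
  all (fun x => x < len sigma) v /\ size v = nth 0 s i.
Proof.
case/exists_inP => u _ /eqP <-; rewrite size_map size_tuple; split=> //.
by apply/allP => _ /mapP [x _ ->]; exact: ltn_ord.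
Qed.

Lemma bounded_tuple n r (v : seq nat) :
  all (fun x => x < n) v -> size v = r ->
  exists t : r.-tuple 'I_n, map val t = v.
Proof.
move=> v_lt v_size.
have pmapK : map val (pmap insub v : seq 'I_n) = v.
  rewrite pmap_filter; last exact: insubK.
  apply/all_filterP; elim: v v_lt {v_size} => //= x v IH /andP [xn /IH ->].
  by rewrite insubT.
have sz : size (pmap insub v : seq 'I_n) == r.
  by rewrite -v_size -{2}pmapK size_map.
by exists (Tuple sz).
Qed.

Lemma structure_ext sigma rho : len sigma = len rho ->
  (forall (i : 'I_(size s)) v,
     all (fun x => x < len sigma) v -> size v = nth 0 s i ->
     holds sigma i v = holds rho i v) ->
  sigma = rho.
Proof.
case: sigma rho => n a [n' b] /= eq_n; rewrite /len /= in eq_n.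
move: eq_n a => <- a {n'} in b * => eq_holds.
congr existT; apply/ffunP => i; apply/setP => t.
rewrite -!(holds_map_val (sigma := existT _ n _)).
rewrite eq_holds ?size_map ?size_tuple //.
by apply/allP => _ /mapP [x _ ->]; exact: ltn_ord.
Qed.

Lemma holds_restrict k l sigma (i : 'I_(size s)) v :
  holds (restrict k l sigma) i v =
  all (fun x => x < l) v && holds sigma i (map (addn k) v).
Proof.
apply/idP/andP => [hv|[v_lt hv]].
  have [v_lt _] := holds_bounded hv; split => //.
  case/exists_inP: hv => u; rewrite /rels /= ffunE inE => uP /eqP <-.
  by move: uP; rewrite /holds -map_comp.
have [_ v_size] := holds_bounded hv; rewrite size_map in v_size.
have [t def_v] := bounded_tuple v_lt v_size.
rewrite -def_v (holds_map_val (sigma := restrict k l sigma)) /rels /= ffunE inE.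
by move: hv; rewrite -def_v -map_comp.
Qed.

Lemma restrict_full sigma : restrict 0 (len sigma) sigma = sigma.
Proof.
apply: structure_ext => // i v v_lt _.
by rewrite holds_restrict v_lt (eq_map add0n) map_id.
Qed.

Lemma restrict_restrict k l k' l' sigma : k + l <= l' ->
  restrict k l (restrict k' l' sigma) = restrict (k' + k) l sigma.
Proof.
move=> kl; apply: structure_ext => // i v v_lt _.
rewrite !holds_restrict v_lt /= -map_comp.
have -> /= : all (fun x => x < l') (map (addn k) v).
  rewrite all_map; apply: sub_all v_lt => x xl /=.
  by apply: leq_trans kl; rewrite ltn_add2l.
by congr holds; apply: eq_map => x /=; rewrite addnA.
Qed.

Lemma cons_le_refl sigma : cons_le sigma sigma.
Proof. by exists 0; rewrite restrict_full. Qed.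

Lemma cons_le_trans sigma rho tau :
  cons_le sigma rho -> cons_le rho tau -> cons_le sigma tau.
Proof.
move=> [k [klen def_sigma]] [k' [klen' def_rho]]; exists (k' + k); split.
  by apply: leq_trans klen'; rewrite -addnA leq_add2l.
by rewrite {1}def_sigma {1}def_rho restrict_restrict.
Qed.

Lemma restrict_le k l sigma :
  k + l <= len sigma -> cons_le (restrict k l sigma) sigma.
Proof. by exists k. Qed.

Lemma cons_le_len_lt sigma rho : cons_le sigma rho -> sigma <> rho ->
  len sigma < len rho.
Proof.
case=> k [klen def_sigma] neq.
rewrite ltn_neqAle (leq_trans (leq_addl k _) klen) andbT.
apply/eqP => eq_len; apply: neq; move: klen.
rewrite -[len rho]add0n -eq_len leq_add2r leqn0 => /eqP k0.
by rewrite def_sigma eq_len k0 restrict_full.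
Qed.

End Restriction.

Section Finiteness.
Variables (s : seq nat) (X : structure s -> Prop).
Hypothesis typeX : structure_type X.

Lemma no_infinite_descending (A : structure s -> Prop) :
  ~ infinite_descending (@cons_le s) A.
Proof.
case=> f [_ desc].
have len_f i : len (f i) + i <= len (f 0).
  elim: i => [|i IH]; first by rewrite addn0.
  case: (desc i) => le_f neq_f; apply: leq_trans IH.
  by rewrite addnS -addSn leq_add2r; apply: cons_le_len_lt.
by have := len_f (len (f 0)).+1; rewrite addnS ltnNge leq_addl.
Qed.

(** Only finitely many structures have length below N, whereas the members of an
    antichain are pairwise distinct. *)
Lemma no_infinite_antichain_bounded (A : structure s -> Prop) N :
  (forall sigma, A sigma -> len sigma < N) ->
  ~ infinite_antichain (@cons_le s) A.
Proof.
move=> bound [f [Af anti]].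
pose T : finType := {n : 'I_N & relations s n}.
pose g i : T := existT (fun n : 'I_N => relations s n)
  (Ordinal (bound _ (Af i))) (tagged (f i)).
have g_inj : injective (fun i : 'I_#|T|.+1 => g i).
  move=> i j eq_g; apply/val_inj/eqP/negPn/negP => /eqP /anti [+ _]; apply.
  have gE k : existT (relations s) (val (tag (g k))) (tagged (g k)) = f k.
    by rewrite /g /=; case: (f k).
  by rewrite -(gE i) -(gE j) eq_g.
by have := leq_card _ g_inj; rewrite card_ord ltnn.
Qed.

Lemma wqo_of_no_long B N :
  (forall sigma, Av X B sigma -> len sigma <> N.+1) ->
  wqo (@cons_le s) (Av X B).
Proof.
move=> no_long; split; last exact: no_infinite_descending.
apply: (@no_infinite_antichain_bounded _ N.+1) => sigma [Xsigma avoid].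
rewrite ltnNge; apply/negP => long.
apply: (no_long (restrict 0 N.+1 sigma)) => //; split.
  exact: type_restrict.
move=> beta betaB le_beta; apply: (avoid beta betaB).
exact: cons_le_trans le_beta (restrict_le _).
Qed.

End Finiteness.

(** * Windows, gluing and antichains *)

Section Windows.
Variables (s : seq nat) (X : structure s -> Prop).
Hypothesis (typeX : structure_type X).

(** The window length m + 1 is what lets validity be applied with overlap m: the
    structure built so far ends with [lambda n], whose last m points are the
    first m points of [lambda n.+1]. *)
Lemma glue_windows (m : nat) (lambda : nat -> structure s) :
  valid X -> 0 < m ->
  (forall j, X (lambda j)) -> (forall j, len (lambda j) = m.+1) ->
  (forall j, restrict 1 m (lambda j) = restrict 0 m (lambda j.+1)) ->
  forall n, exists theta, [/\ X theta, len theta = n + m.+1 &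
    forall j, j <= n -> restrict j m.+1 theta = lambda j].
Proof.
move=> validX m_gt0 Xl len_l step; elim=> [|n [theta [Xt len_t win]]].
  exists (lambda 0); rewrite len_l; split=> // j; rewrite leqn0 => /eqP ->.
  by rewrite -(len_l 0) restrict_full.
have len_tm : len theta - m = n.+1 by rewrite len_t addnS -addSn addnK.
have ov : overlap m theta (lambda n.+1).
  split=> //; first by rewrite len_t addnS -addSn leq_addl.
    by rewrite len_l.
  by rewrite len_tm -step -(win n (leqnn n)) restrict_restrict ?addn1.
have [theta' Xt' [len_t']] := validX _ _ _ Xt (Xl n.+1) ov.
rewrite len_tm len_l => pref suff; exists theta'; split=> // [|j].
  by rewrite len_t' len_l len_t -addnBA // subSnn addn1.
rewrite leq_eqVlt => /orP [/eqP -> //|]; rewrite ltnS => jn.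
by rewrite -(win j jn) -pref restrict_restrict // len_t leq_add2r.
Qed.

(** Pigeonhole principle: there is one more position than structures of
    length m. *)
Lemma repeated_window (m : nat) (sigma : structure s) :
  exists p q, [/\ p < q, q <= #|{: relations s m}| &
    restrict p m sigma = restrict q m sigma].
Proof.
pose w (p : 'I_#|{: relations s m}|.+1) : relations s m :=
  tagged (restrict p m sigma).
have /injectivePn [p [q neq_pq eq_w]] : ~~ injectiveb w.
  by apply/injectiveP => /leq_card; rewrite card_ord ltnn.
have eq_win : restrict p m sigma = restrict q m sigma.
  by congr (Tagged (relations s)); exact: eq_w.
case: (ltngtP p q) => [pq|qp|/val_inj eq_pq].
- by exists p, q; rewrite pq -ltnS ltn_ord.
- by exists q, p; rewrite qp -ltnS ltn_ord.
- by rewrite eq_pq eqxx in neq_pq.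
Qed.

Lemma sub_window beta (tau : structure s) m :
  0 < m -> len tau = m.+1 -> len beta <= m -> cons_le beta tau ->
  cons_le beta (restrict 0 m tau) \/ cons_le beta (restrict 1 m tau).
Proof.
move=> m_gt0 len_tau len_b [o [o_le def_b]].
case: (leqP (o + len beta) m) => o_m.
  by left; exists o; rewrite restrict_restrict ?add0n.
case: o o_le o_m def_b => [|o] o_le o_m def_b.
  by rewrite ltnNge len_b in o_m.
rewrite len_tau addSn ltnS in o_le.
by right; exists o; rewrite restrict_restrict ?add1n.
Qed.

Hypothesis bountX : bountiful X.

(** A repeated window yields a closed walk, and the choice between two
    structures on one of its steps is used as an end marker: structures that go
    round the walk different numbers of times, marked at both ends only, are
    incomparable. *)
Lemma antichain_of_long (B : seq (structure s)) m sigma :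
  0 < m -> (forall beta, beta \in B -> len beta <= m) ->
  Av X B sigma -> len sigma = #|{: relations s m}| + m ->
  infinite_antichain (@cons_le s) (Av X B).
Proof.
move=> m_gt0 len_B [Xs avoid] len_s.
have [p [q [lt_pq le_q eq_win]]] := repeated_window m sigma.
pose L := q - p; have L_gt0 : 0 < L by rewrite subn_gt0.
pose w j := restrict (p + j %% L) m sigma.
pose u j := restrict (p + j %% L) m.+1 sigma.
have pos j : p + j %% L + m.+1 <= len sigma.
  rewrite addnS -addSn len_s leq_add2r (leq_trans _ le_q) // -addnS.
  by rewrite -leq_subRL ?ltn_mod // ltnW.
have Xu j : X (u j) by apply: type_restrict.
have w_le j : cons_le (w j) sigma.
  by apply: restrict_le; apply: leq_trans (pos j); rewrite addnS leqnSn.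
have u0 j : restrict 0 m (u j) = w j by rewrite restrict_restrict ?addn0.
have u1 j : restrict 1 m (u j) = w j.+1.
  rewrite restrict_restrict // /w -addnA addn1 modnS.
  case: ifP => // /dvdnP [c eq_c].
  have -> : (j %% L).+1 = L; last by rewrite addn0 eq_win subnKC // ltnW.
  apply/eqP; rewrite eqn_leq ltn_mod L_gt0 /= dvdn_leq //.
  have : L %| j.+1 by rewrite eq_c dvdn_mull.
  by rewrite {1}(divn_eq j L) -addnS dvdn_addr // dvdn_mull.
have [theta1 [theta2 [neq_theta theta_prop]]] :
  exists theta1 theta2, theta1 <> theta2 /\
    forall theta, theta = theta1 \/ theta = theta2 ->
    [/\ X theta, len theta = m.+1,
        restrict 0 m theta = w 0 & restrict 1 m theta = w 1].
  have Xw j : X (w j) by rewrite -u0; apply: type_restrict => //; exact: leqW.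
  apply: bountX.2 => //.
  by rewrite -(u0 0) -(u1 0) !restrict_restrict ?add1n ?prednK ?leq_pred.
have [X1 len1 l1 r1] := theta_prop theta1 (or_introl erefl).
have [X2 len2 l2 r2] := theta_prop theta2 (or_intror erefl).
(* The step from position p may recur within the cycle, so theta2 has to be
   removed wherever it occurs, not only at multiples of L. *)
pose phi j := if u j == theta2 then theta1 else u j.
have phi_prop j : [/\ X (phi j), len (phi j) = m.+1, phi j <> theta2,
    restrict 0 m (phi j) = w j & restrict 1 m (phi j) = w j.+1].
  rewrite /phi; case: eqP => [eq_u|neq_u]; last by split.
  by rewrite -u0 -u1 eq_u l2 r2; split.
pose lambda T j := if (j == 0) || (j == T) then theta2 else phi j.
have w_mul c j : w (c * L + j) = w j by rewrite /w modnMDl.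
have lambda_prop n j : [/\ X (lambda (n.+1 * L) j),
    len (lambda (n.+1 * L) j) = m.+1,
    restrict 0 m (lambda (n.+1 * L) j) = w j &
    restrict 1 m (lambda (n.+1 * L) j) = w j.+1].
  rewrite /lambda; case: ifP => [/orP [] /eqP ->|_].
  - by rewrite l2 r2.
  - have := w_mul n.+1 0; have := w_mul n.+1 1; rewrite addn0 addn1 => -> ->.
    by rewrite l2 r2.
  - by case: (phi_prop j).
have /functional_choice [f f_prop] : forall n, exists theta : structure s,
    [/\ X theta, len theta = n.+1 * L + m.+1 &
    forall j, j <= n.+1 * L -> restrict j m.+1 theta = lambda (n.+1 * L) j].
  move=> n; apply: glue_windows => // [|j|j|j].
  - exact: bountX.1.
  - by case: (lambda_prop n j).
  - by case: (lambda_prop n j).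
  - by case: (lambda_prop n j) => _ _ _ ->; case: (lambda_prop n j.+1).
(* The marker theta2 starting f i is met in f j at its two ends only.  The
   final end leaves no room, so the shift k is 0, and then the marker ending f i
   has to be the marker ending f j. *)
have f_incomp i j : cons_le (f i) (f j) -> i = j.
  case: (f_prop i) (f_prop j) => _ len_i win_i [_ len_j win_j] [k []].
  rewrite len_i len_j addnA leq_add2r => k_le def_f.
  have shift x : x <= i.+1 * L ->
      lambda (i.+1 * L) x = lambda (j.+1 * L) (k + x).
    move=> xi; rewrite -win_i // def_f restrict_restrict ?leq_add2r // win_j //.
    by apply: leq_trans k_le; rewrite leq_add2l.
  have ends T x : lambda T x = theta2 -> x = 0 \/ x = T.
    rewrite /lambda; case: ifP => [/orP [] /eqP -> //|_]; try by [left|right].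
    by case: (phi_prop x).
  have k0 : k = 0.
    have := shift 0 isT; rewrite /lambda eqxx => /esym /ends; rewrite addn0.
    case=> // eq_k; move: k_le; rewrite eq_k leqNgt -addn1 leq_add2l.
    by rewrite muln_gt0 L_gt0.
  have := shift _ (leqnn _); rewrite k0 {1}/lambda eqxx orbT => /esym /ends [].
    by move/eqP; rewrite muln_eq0 (gtn_eqF L_gt0).
  by move/eqP; rewrite eqn_pmul2r // => /eqP [].
exists f; split=> [n|i j neq_ij]; last first.
  split=> [eq_f|/f_incomp //]; apply/neq_ij/f_incomp; rewrite eq_f.
  exact: cons_le_refl.
have [Xf len_f win_f] := f_prop n; split=> // beta betaB [k [k_le def_b]].
rewrite len_f in k_le.
(* A window of length m + 1 that contains the occurrence of beta: the last
   window starts at n.+1 * L, and any earlier one can start where beta does. *)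
have [j [jT jk kj]] : exists j, [/\ j <= n.+1 * L, j <= k &
    k - j + len beta <= m.+1].
  case: (leqP k (n.+1 * L)) => [kT|/ltnW Tk].
    by exists k; rewrite subnn add0n leqW // len_B.
  exists (n.+1 * L); split=> //.
  by rewrite -(leq_add2l (n.+1 * L)) addnA subnKC.
have [_ len_l l_l l_r] := lambda_prop n j.
have b_le : cons_le beta (lambda (n.+1 * L) j).
  rewrite -win_f //; exists (k - j); split=> //.
  by rewrite restrict_restrict ?subnKC.
apply: (avoid beta betaB).
case: (sub_window m_gt0 len_l (len_B _ betaB) b_le) => /cons_le_trans; apply.
  by rewrite l_l.
by rewrite l_r.
Qed.
End Windows.

(** * Closure properties of computable functions *)

(** Functions of an environment, in which variables are positions and every
    missing value is 0.  Quantifying over all tuple lengths makes weakening,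
    substitution and binding of variables operations on lists, without any
    dependent type. *)
Definition computable (f : seq nat -> nat) : Prop :=
  forall k, recursive (fun x : k.-tuple nat => f x).

Lemma recursive_ext k (f g : k.-tuple nat -> nat) :
  recursive f -> f =1 g -> recursive g.
Proof. by move=> fP /functional_extensionality <-. Qed.

Lemma computable_ext f g : computable f -> f =1 g -> computable g.
Proof. by move=> fP /functional_extensionality <-. Qed.

Lemma computable_var i : computable (fun e => nth 0 e i).
Proof.
move=> k; case: (ltnP i k) => ik.
  apply: recursive_ext (rec_proj (Ordinal ik)) _ => x.
  by rewrite (tnth_nth 0).
apply: recursive_ext (rec_zero k) _ => x.
by rewrite nth_default ?size_tuple.
Qed.

(** General substitution: weakening, skipping and pushing a variable are the
    instances below.  Since g may change the number of variables, its output
    size has to depend on the input size only. *)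
Lemma computable_subst f (g : seq nat -> seq nat) :
  (forall e e', size e = size e' -> size (g e) = size (g e')) ->
  (forall i, computable (fun e => nth 0 (g e) i)) ->
  computable f -> computable (fun e => f (g e)).
Proof.
move=> size_g gP fP k; pose m := size (g (nseq k 0)).
apply: recursive_ext (rec_comp (fP m) (fun i : 'I_m => gP i k)) _ => x.
congr f; apply: (@eq_from_nth _ 0) => [|i].
  by rewrite size_tuple; apply: size_g; rewrite size_nseq size_tuple.
rewrite size_tuple => ilt.
by rewrite -{1}[i]/(nat_of_ord (Ordinal ilt)) -tnth_nth tnth_mktuple.
Qed.

Lemma computable_succ f : computable f -> computable (fun e => (f e).+1).
Proof.
move=> fP k; apply: recursive_ext (rec_comp rec_succ (fun _ => fP k)) _ => x.
by rewrite tnth_mktuple.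
Qed.

Lemma computable_const c : computable (fun=> c).
Proof. by elim: c => [k|c /computable_succ //]; exact: rec_zero. Qed.

Lemma computable_weak f : computable f -> computable (fun e => f (behead e)).
Proof.
apply: computable_subst => [e e' eq_e|i]; first by rewrite !size_behead eq_e.
by apply: computable_ext (computable_var i.+1) _ => e; rewrite nth_behead.
Qed.

Lemma computable_skip f :
  computable f -> computable (fun e => f (nth 0 e 0 :: behead (behead e))).
Proof.
apply: computable_subst => [e e' eq_e|i]; first by rewrite /= !size_behead eq_e.
case: i => [|i]; first exact: computable_var.
by apply: computable_ext (computable_var i.+2) _ => e; rewrite /= !nth_behead.
Qed.

Lemma computable_push f n :
  computable f -> computable n -> computable (fun e => f (n e :: e)).
Proof.
move=> fP nP; apply: computable_subst fP => [e e' eq_e|[|i]] //=.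
  by rewrite eq_e.
exact: computable_var.
Qed.

(** In G the counter is variable 0 and the previous value is variable 1, so the
    parameters are found two places further on. *)
Lemma computable_primrec (f n : seq nat -> nat)
    (G : nat -> nat -> seq nat -> nat) (H : nat -> seq nat -> nat) :
  computable f -> computable n ->
  computable (fun e => G (nth 0 e 0) (nth 0 e 1) (behead (behead e))) ->
  H 0 =1 f -> (forall i e, H i.+1 e = G i (H i e) e) ->
  computable (fun e => H (n e) e).
Proof.
move=> fP nP GP H0 HS.
have HP : computable (fun e => H (nth 0 e 0) (behead e)).
  case=> [|k].
    by apply: recursive_ext (fP 0) _ => x; rewrite tuple0 /= H0.
  apply: (@rec_prim k (fun x => f x)
    (fun x => G (nth 0 x 0) (nth 0 x 1) (behead (behead x)))) => //=.
exact: computable_push HP nP.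
Qed.

Lemma computable_weak2 f :
  computable f -> computable (fun e => f (behead (behead e))).
Proof.
by move=> /computable_weak; apply: (@computable_weak (fun e => f (behead e))).
Qed.

Lemma computable_add a b :
  computable a -> computable b -> computable (fun e => a e + b e).
Proof.
move=> aP bP.
apply: (computable_primrec (G := fun _ r _ => r.+1)
  (H := fun i e => i + b e)) bP aP _ _ _ => //.
exact/computable_succ/computable_var.
Qed.

Lemma computable_mul a b :
  computable a -> computable b -> computable (fun e => a e * b e).
Proof.
move=> aP bP.
apply: (computable_primrec (G := fun _ r e => b e + r)
    (H := fun i e => i * b e))
  (computable_const 0) aP _ _ _ => // .
by apply: computable_add; [exact: computable_weak2 | exact: computable_var].
Qed.

Lemma computable_exp a b :
  computable a -> computable b -> computable (fun e => a e ^ b e).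
Proof.
move=> aP bP.
apply: (computable_primrec (G := fun _ r e => a e * r)
    (H := fun i e => a e ^ i))
  (computable_const 1) bP _ _ _ => // [|i e]; last by rewrite expnS.
by apply: computable_mul; [exact: computable_weak2 | exact: computable_var].
Qed.

Lemma computable_pred a : computable a -> computable (fun e => (a e).-1).
Proof.
move=> aP; apply: (computable_primrec (G := fun i _ _ => i)
    (H := fun i _ => i.-1)) (computable_const 0) aP _ _ _ => //.
exact: computable_var.
Qed.

Lemma computable_sub a b :
  computable a -> computable b -> computable (fun e => a e - b e).
Proof.
move=> aP bP.
apply: (computable_primrec (G := fun _ r _ => r.-1)
  (H := fun i e => a e - i)) aP bP _ _ _ => [|e|i e].
- exact/computable_pred/computable_var.
- by rewrite subn0.
- by rewrite subnS.
Qed.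

Lemma computableb_leq a b :
  computable a -> computable b -> computable (fun e => a e <= b e).
Proof.
move=> aP bP; apply: computable_ext
  (computable_sub (computable_const 1) (computable_sub aP bP)) _ => e.
by rewrite /leq; case: (a e - b e).
Qed.

Lemma computableb_neg (b : seq nat -> bool) :
  computable (fun e => b e) -> computable (fun e => ~~ b e).
Proof.
move=> bP.
apply: computable_ext (computable_sub (computable_const 1) bP) _ => e.
by case: (b e).
Qed.

Lemma computableb_and (a b : seq nat -> bool) :
  computable (fun e => a e) -> computable (fun e => b e) ->
  computable (fun e => a e && b e).
Proof.
move=> aP bP; apply: computable_ext (computable_mul aP bP) _ => e.
by rewrite mulnb.
Qed.

Lemma computableb_eq a b :
  computable a -> computable b -> computable (fun e => a e == b e).
Proof.
move=> aP bP.
apply: computable_ext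
  (computableb_and (computableb_leq aP bP) (computableb_leq bP aP)) _ => e.
by rewrite eqn_leq.
Qed.

(** Bounded operators bind variable 0 of the environment; the premise on F is
    the computability of the body under this binder. *)
Lemma computable_sum (F : nat -> seq nat -> nat) n :
  computable (fun e => F (nth 0 e 0) (behead e)) -> computable n ->
  computable (fun e => \sum_(0 <= i < n e) F i e).
Proof.
move=> FP nP; apply: (computable_primrec (G := fun i r e => r + F i e)
  (H := fun i e => \sum_(0 <= j < i) F j e))
  (computable_const 0) nP _ _ _ => [|e|i e].
- apply: computable_add; first exact: computable_var.
  exact: computable_skip FP.
- by rewrite big_geq.
- by rewrite big_nat_recr.
Qed.

Lemma computableb_has (F : nat -> seq nat -> bool) n :
  computable (fun e => F (nth 0 e 0) (behead e)) -> computable n ->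
  computable (fun e => has (fun i => F i e) (iota 0 (n e))).
Proof.
move=> FP nP; apply: computable_ext (computableb_leq (computable_const 1)
  (computable_sum (F := fun i e => F i e : nat) FP nP)) _ => e.
congr nat_of_bool; rewrite lt0n sum_nat_seq_eq0 /= -has_predC /index_iota subn0.
by apply: eq_has => i /=; case: (F i e).
Qed.

Lemma computableb_all (F : nat -> seq nat -> bool) n :
  computable (fun e => F (nth 0 e 0) (behead e)) -> computable n ->
  computable (fun e => all (fun i => F i e) (iota 0 (n e))).
Proof.
move=> FP nP.
apply: computable_ext (computableb_neg
  (computableb_has (F := fun i e => ~~ F i e) (computableb_neg FP) nP)) _ => e.
by rewrite -all_predC; congr nat_of_bool; apply: eq_all => i /=; rewrite negbK.
Qed.

Lemma computableb_all_const (T : Type) (F : T -> seq nat -> bool) l :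
  (forall i, computable (F i)) -> computable (fun e => all (fun i => F i e) l).
Proof.
move=> FP; elim: l => [|i l IH] /=; first exact: computable_const.
exact: computableb_and.
Qed.

Lemma computable_iter (F : nat -> nat) n a :
  computable (fun e => F (nth 0 e 0)) -> computable n -> computable a ->
  computable (fun e => iter (n e) F (a e)).
Proof.
move=> FP nP aP.
apply: (computable_primrec (G := fun _ r _ => F r)
  (H := fun i e => iter i F (a e))) aP nP _ _ _ => //.
apply: (computable_subst (g := fun e => [:: nth 0 e 1])) FP => // [[|i]] /=.
  exact: computable_var.
by rewrite nth_nil; exact: computable_const.
Qed.

(** * Lists decoded from numbers *)

Lemma sum_ltn n q : q <= n -> \sum_(0 <= i < n) (i < q) = q.
Proof.
move=> qn; rewrite (big_cat_nat (n := q)) //= [X in _ + X]big_nat_cond.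
rewrite [X in _ + X]big1 ?addn0 => [|i /andP [/andP [qi _] _]].
  2: by rewrite ltnNge qi.
rewrite big_nat_cond (eq_bigr (fun=> 1)) => [|i /andP [/andP [_ ->]] //].
by rewrite -big_nat_cond sum_nat_const_nat subn0 muln1.
Qed.

(** The quotient of a by d is the number of i < a with (i + 1) d <= a. *)
Lemma computable_div_exp a b :
  computable a -> computable b -> computable (fun e => a e %/ 2 ^ b e).
Proof.
move=> aP bP.
apply: computable_ext (computable_sum
  (F := fun i e => i.+1 * 2 ^ b e <= a e) _ aP) _ => [|e].
  apply: computableb_leq; last exact: computable_weak.
  apply: computable_mul; first exact/computable_succ/computable_var.
  by apply: computable_exp; [exact: computable_const | exact: computable_weak].
under eq_bigr => i _ do rewrite -leq_divRL ?expn_gt0 //.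
by rewrite sum_ltn // leq_div.
Qed.

Lemma computableb_odd a : computable a -> computable (fun e => odd (a e)).
Proof.
move=> aP; apply: (computable_primrec (G := fun _ r _ => 1 - r)
  (H := fun i _ => odd i)) (computable_const 0) aP _ _ _ => //= [|i _].
  by apply: computable_sub; [exact: computable_const | exact: computable_var].
by case: (odd i).
Qed.

Lemma computable_logn2 a : computable a -> computable (fun e => logn 2 (a e)).
Proof.
move=> aP.
apply: computable_ext (computable_sum
  (F := fun i e => a e %/ 2 ^ i.+1 * 2 ^ i.+1 == a e)
  _ (computable_pred aP)) _ => [|e].
  have iP := computable_succ (computable_var 0).
  apply: computableb_eq; last exact: computable_weak.
  apply: computable_mul.
    by apply: computable_div_exp iP; exact: computable_weak.
  by apply: computable_exp iP; exact: computable_const.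
rewrite logn_count_dvd // big_add1.
by apply: eq_bigr => i _; rewrite dvdn_eq.
Qed.

Definition bit p a := odd (a %/ 2 ^ p).

Lemma computableb_bit p a :
  computable p -> computable a -> computable (fun e => bit (p e) (a e)).
Proof. by move=> pP aP; apply: computableb_odd; apply: computable_div_exp. Qed.

(** The code of a nonempty list with head n and tail l is 2 ^ n times the odd
    number 2 c + 1, where c is the code of l.  Hence [logn 2] reads the head. *)
Definition code_tail c := c %/ 2 ^ logn 2 c %/ 2.

Definition entry j c := logn 2 (iter j code_tail c).

Lemma computable_iter_tail j a : computable j -> computable a ->
  computable (fun e => iter (j e) code_tail (a e)).
Proof.
apply: computable_iter; have vP := computable_var 0.
apply: computable_ext (computable_div_exp
  (computable_div_exp vP (computable_logn2 vP)) (computable_const 1)) _ => e.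
by rewrite expn1.
Qed.

Lemma computable_entry j a :
  computable j -> computable a -> computable (fun e => entry (j e) (a e)).
Proof. by move=> jP /(computable_iter_tail jP)/computable_logn2. Qed.

Lemma code_tail_code l : code_tail (CodeSeq.code l) = CodeSeq.code (behead l).
Proof.
case: l => [|n l] //=; rewrite /code_tail lognM ?expn_gt0 // pfactorK //.
rewrite (@logn_coprime 2) ?coprime2n /= ?odd_double //.
by rewrite addn0 mulKn ?expn_gt0 // divn2 /= uphalf_double.
Qed.

Lemma iter_code_tail j l :
  iter j code_tail (CodeSeq.code l) = CodeSeq.code (drop j l).
Proof.
elim: j l => [|j IH] l; first by rewrite drop0.
by rewrite iterSr code_tail_code IH; case: l.
Qed.

Lemma code_eq0 l : (CodeSeq.code l == 0) = nilp l.
Proof. by case: l => //= n l; rewrite muln_eq0 expn_eq0. Qed.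

(** Beyond the end of l both sides are 0: the code of the empty list is 0 and so
    is [logn 2 0]. *)
Lemma entry_code j l : entry j (CodeSeq.code l) = nth 0 l j.
Proof.
rewrite /entry iter_code_tail; case: (ltnP j (size l)) => jl.
  rewrite (drop_nth 0) //= lognM ?expn_gt0 // pfactorK //.
  by rewrite (@logn_coprime 2) ?addn0 // coprime2n /= odd_double.
by rewrite nth_default // drop_oversize.
Qed.

Lemma size_le_code l : size l <= CodeSeq.code l.
Proof.
elim: l => //= n l IH; rewrite -[_.+1]mul1n leq_mul ?expn_gt0 // ltnS.
by rewrite (leq_trans IH) // -addnn leq_addr.
Qed.

(** * Numbers as sets of exponents *)

Lemma odd_bit_sum M (c : nat -> bool) :
  \sum_(j < M.+1) c j * 2 ^ j = c 0 + (\sum_(j < M) c j.+1 * 2 ^ j).*2.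
Proof.
rewrite big_ord_recl muln1 -mul2n big_distrr; congr (_ + _).
by apply: eq_bigr => j _; rewrite /= expnS mulnCA.
Qed.

Lemma bitS p a : bit p.+1 a = bit p a./2.
Proof. by rewrite /bit expnS divnMA divn2. Qed.

Lemma bit_sum M (c : nat -> bool) p :
  bit p (\sum_(j < M) c j * 2 ^ j) = (p < M) && c p.
Proof.
elim: M c p => [|M IH] c p; first by rewrite big_ord0 /bit div0n.
rewrite odd_bit_sum; case: p => [|p].
  by rewrite /bit divn1 oddD odd_double addbF oddb.
by rewrite bitS half_bit_double (IH (fun j => c j.+1)).
Qed.

Lemma bit_sum_lt M (c : nat -> bool) : \sum_(j < M) c j * 2 ^ j < 2 ^ M.
Proof.
elim: M c => [|M IH] c; first by rewrite big_ord0.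
rewrite odd_bit_sum expnS mul2n -ltn_half_double half_bit_double.
exact: (IH (fun j => c j.+1)).
Qed.

Lemma sum_bits M a : a < 2 ^ M -> \sum_(j < M) bit j a * 2 ^ j = a.
Proof.
elim: M a => [|M IH] a; first by rewrite big_ord0; case: a.
rewrite expnS mul2n -ltn_half_double => /IH eq_a.
rewrite (odd_bit_sum _ (bit^~ a)).
rewrite -[RHS]odd_double_half -[in RHS]eq_a /bit divn1.
by congr (_ + _.*2); apply: eq_bigr => j _; rewrite -/(bit _ _) bitS.
Qed.

(** * Codes of relations *)

(** The initial value p stands for digits more significant than those of v; this
    is what makes [tuple_index] computable by the recursion of [agree]. *)
Definition digits n p (v : seq nat) := foldr (fun x a => x + n * a) p v.

Lemma tuple_indexE n (t : seq 'I_n) : tuple_index t = digits n 0 (map val t).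
Proof. by rewrite /digits foldr_map. Qed.

Lemma digits_lt n v : all (fun x => x < n) v -> digits n 0 v < n ^ size v.
Proof.
elim: v => //= x v IH /andP [xn /IH lt_v]; rewrite expnS.
apply: leq_trans (_ : n + n * digits n 0 v <= _).
  by rewrite -addSn leq_add2r.
by rewrite -mulnS leq_mul2l lt_v orbT.
Qed.

Lemma digits_inj n v w : size v = size w ->
  all (fun x => x < n) v -> all (fun x => x < n) w ->
  digits n 0 v = digits n 0 w -> v = w.
Proof.
elim: v w => [|x v IH] [|y w] //= [eq_size] /andP [xn vn] /andP [yn wn].
rewrite ![_ + n * _]addnC ![n * _]mulnC => eq_d.
have n_gt0 : 0 < n by case: n xn {IH vn yn wn eq_d}.
have eq_xy : x = y.
  by have := congr1 (modn^~ n) eq_d; rewrite !modnMDl !modn_small.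
move: eq_d; rewrite eq_xy => /addIn /eqP; rewrite eqn_pmul2r // => /eqP eq_d.
by rewrite (IH w).
Qed.

Lemma all_lt_val n (t : seq 'I_n) : all (fun x => x < n) (map val t).
Proof. by apply/allP => _ /mapP [x _ ->]; exact: ltn_ord. Qed.

Lemma tuple_index_lt n r (t : r.-tuple 'I_n) : tuple_index t < n ^ r.
Proof.
by have := digits_lt (all_lt_val t); rewrite tuple_indexE size_map size_tuple.
Qed.

Lemma tuple_index_inj n r : injective (fun t : r.-tuple 'I_n => tuple_index t).
Proof.
move=> t u; rewrite !tuple_indexE => eq_tu; apply/val_inj/(inj_map val_inj).
by apply: digits_inj eq_tu; rewrite ?all_lt_val // !size_map !size_tuple.
Qed.

(** The index of a tuple is an injection into an ordinal type of the same
    cardinality, hence a bijection. *)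
Lemma sum_tuple_index n r (F : nat -> nat) :
  \sum_(t : r.-tuple 'I_n) F (tuple_index t) = \sum_(j < n ^ r) F j.
Proof.
pose f (t : r.-tuple 'I_n) := Ordinal (tuple_index_lt t).
have f_inj : injective f by move=> t u [/tuple_index_inj].
rewrite [RHS](reindex f) //=; apply: onW_bij; apply: (inj_card_bij f_inj).
by rewrite card_ord card_tuple card_ord.
Qed.

Lemma code_rel_sum n r (R : {set r.-tuple 'I_n}) (c : nat -> bool) :
  (forall t : r.-tuple 'I_n, c (tuple_index t) = (t \in R)) ->
  code_rel R = \sum_(j < n ^ r) c j * 2 ^ j.
Proof.
move=> cE; rewrite -(@sum_tuple_index n r (fun j => c j * 2 ^ j)) /code_rel.
rewrite big_mkcond; apply: eq_bigr => t _.
by rewrite cE; case: (t \in R); rewrite ?mul1n ?mul0n.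
Qed.

Lemma code_rel_bits n r (R : {set r.-tuple 'I_n}) :
  exists2 c : nat -> bool,
    forall t : r.-tuple 'I_n, c (tuple_index t) = (t \in R) &
    code_rel R = \sum_(j < n ^ r) c j * 2 ^ j.
Proof.
pose c j := [exists t in R, tuple_index (tval t) == j].
suff cE (t : r.-tuple 'I_n) : c (tuple_index t) = (t \in R).
  by exists c => //; exact: code_rel_sum.
apply/exists_inP/idP => [[u uR /eqP /tuple_index_inj <-] //|tR].
by exists t.
Qed.

Lemma code_rel_lt n r (R : {set r.-tuple 'I_n}) : code_rel R < 2 ^ n ^ r.
Proof. by have [c _ ->] := code_rel_bits R; exact: bit_sum_lt. Qed.

Lemma bit_code_rel n r (R : {set r.-tuple 'I_n}) (t : r.-tuple 'I_n) :
  bit (tuple_index t) (code_rel R) = (t \in R).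
Proof.
by have [c cE ->] := code_rel_bits R; rewrite bit_sum tuple_index_lt cE.
Qed.

(** Every number of the right size is the code of a relation, so that a search
    over numbers is a search over all relations. *)
Lemma code_rel_onto n r a : a < 2 ^ n ^ r ->
  code_rel [set t : r.-tuple 'I_n | bit (tuple_index t) a] = a.
Proof.
move=> /sum_bits {2}<-.
by apply: (code_rel_sum (c := bit^~ a)) => t; rewrite inE.
Qed.

(** Comparison, on all tuples of arity r, of the relation coded by a on n points
    with the relation coded by b on N points, shifted by k.  The r points are
    quantified from the last one to the first; p and q accumulate the indices of
    the tuple and of its shift. *)
Fixpoint agree r n N k a b p q :=
  if r is r'.+1 then
    all (fun x => agree r' n N k a b (x + n * p) (k + x + N * q)) (iota 0 n)
  else bit p a == bit q b.

Lemma agreeP r n N k a b p q :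
  reflect (forall v, all (fun x => x < n) v -> size v = r ->
             bit (digits n p v) a = bit (digits N q (map (addn k) v)) b)
          (agree r n N k a b p q).
Proof.
elim: r p q => [|r IH] p q /=.
  by apply: (iffP eqP) => [eq_b [|] //|/(_ [::] isT erefl)].
apply: (iffP allP) => [agr v|agr x].
  elim/last_ind: v => // v x _.
  rewrite all_rcons size_rcons => /andP [xn vn] [v_size].
  have /agr /IH : x \in iota 0 n by rewrite mem_iota.
  by rewrite map_rcons /digits !foldr_rcons; apply.
rewrite mem_iota => /= xn; apply/IH => v vn v_size.
have := agr (rcons v x).
rewrite all_rcons size_rcons vn v_size xn => /(_ isT erefl).
by rewrite map_rcons /digits !foldr_rcons.
Qed.

Lemma computable_agree r n N k a b p q :
  computable n -> computable N -> computable k -> computable a ->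
  computable b -> computable p -> computable q ->
  computable (fun e => agree r (n e) (N e) (k e) (a e) (b e) (p e) (q e)).
Proof.
elim: r n N k a b p q => [|r IH] n N k a b p q nP NP kP aP bP pP qP /=.
  apply: computable_ext
    (computableb_eq (computableb_bit pP aP) (computableb_bit qP bP)) _ => e.
  by case: (bit _ _); case: (bit _ _).
pose F x e := agree r (n e) (N e) (k e) (a e) (b e)
  (x + n e * p e) (k e + x + N e * q e).
apply: (computableb_all (F := F) _ nP); rewrite {}/F.
have xP := computable_var 0.
do [move: nP NP kP aP bP pP qP;
  do 7 move=> /computable_weak ?].
apply: IH => //; apply: computable_add => //; try exact: computable_add.
  exact: computable_mul.
exact: computable_mul.
Qed.

(** * Structures decoded from numbers *)

Section Codes.
Variable s : seq nat.
Implicit Types sigma rho beta : structure s.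

Lemma entry_len sigma : entry 0 (code_structure sigma) = len sigma.
Proof. by rewrite entry_code. Qed.

Lemma entry_rel sigma (i : 'I_(size s)) :
  entry i.+1 (code_structure sigma) = code_rel (rels sigma i).
Proof.
rewrite entry_code /= (nth_map i) ?size_enum_ord //.
by rewrite nth_ord_enum.
Qed.

Lemma bit_entry sigma (i : 'I_(size s)) v :
  all (fun x => x < len sigma) v -> size v = nth 0 s i ->
  bit (digits (len sigma) 0 v) (entry i.+1 (code_structure sigma)) =
  holds sigma i v.
Proof.
move=> v_lt v_size; have [t <-] := bounded_tuple v_lt v_size.
by rewrite holds_map_val -tuple_indexE entry_rel bit_code_rel.
Qed.

(** The consecutive order on codes: the relation i of a structure is the entry
    i + 1 of its code, the entry 0 being its length. *)
Definition cons_le_code b c :=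
  has (fun k => (k + entry 0 b <= entry 0 c) &&
    all (fun i => agree (nth 0 s i) (entry 0 b) (entry 0 c) k
                    (entry i.+1 b) (entry i.+1 c) 0 0) (iota 0 (size s)))
    (iota 0 (entry 0 c).+1).

Lemma cons_le_codeP beta sigma :
  reflect (cons_le beta sigma)
          (cons_le_code (code_structure beta) (code_structure sigma)).
Proof.
rewrite /cons_le_code !entry_len.
have shift k v : k + len beta <= len sigma -> all (fun x => x < len beta) v ->
    all (fun x => x < len sigma) (map (addn k) v).
  move=> k_le; rewrite all_map; apply: sub_all => x x_lt /=.
  by apply: leq_trans k_le; rewrite ltn_add2l.
apply: (iffP hasP) => [[k _ /andP [k_le /allP agr]]|[k [k_le def_b]]].
  exists k; split=> //; apply: structure_ext => // i v v_lt v_size.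
  have i_in : val i \in iota 0 (size s) by rewrite mem_iota /= ltn_ord.
  have /agreeP/(_ v v_lt v_size) := agr _ i_in.
  by rewrite holds_restrict v_lt !bit_entry ?size_map ?shift.
exists k; first by rewrite mem_iota /= ltnS (leq_trans (leq_addr _ _) k_le).
rewrite k_le; apply/allP => i; rewrite mem_iota /= => i_lt.
apply/agreeP => v v_lt v_size.
rewrite (@bit_entry beta (Ordinal i_lt)) //.
rewrite (@bit_entry sigma (Ordinal i_lt)) ?size_map ?shift //.
by rewrite {1}def_b holds_restrict v_lt.
Qed.

Definition avoids_code y c :=
  ~~ has (fun j => (iter j code_tail y != 0) && cons_le_code (entry j y) c)
       (iota 0 y).

Lemma avoids_codeP (B : seq (structure s)) sigma :
  reflect (forall beta, beta \in B -> ~ cons_le beta sigma)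
          (avoids_code (code_structures B) (code_structure sigma)).
Proof.
apply: (iffP hasPn) => [avoid beta betaB|avoid j _].
  have idx_lt : index beta B < size B by rewrite index_mem.
  have idx_in : index beta B \in iota 0 (code_structures B).
    rewrite mem_iota (leq_trans idx_lt) // add0n.
    rewrite -(size_map (@code_structure s)).
    exact: size_le_code.
  have := avoid _ idx_in; rewrite iter_code_tail code_eq0 entry_code.
  rewrite (nth_map beta) // nth_index // => ok /cons_le_codeP le_b.
  move: ok; rewrite le_b andbT negbK /nilp size_drop size_map subn_eq0.
  by rewrite leqNgt idx_lt.
rewrite iter_code_tail code_eq0 entry_code.
rewrite /nilp size_drop size_map subn_eq0 -ltnNge.
case: ltnP => //= j_lt; case: B => [|beta B] // in avoid j_lt *.
rewrite (nth_map beta) //; apply/cons_le_codeP/avoid; exact: mem_nth.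
Qed.

Lemma computable_cons_le_code b c : computable b -> computable c ->
  computable (fun e => cons_le_code (b e) (c e)).
Proof.
move=> bP cP; rewrite /cons_le_code.
pose F k e := (k + entry 0 (b e) <= entry 0 (c e)) &&
  all (fun i => agree (nth 0 s i) (entry 0 (b e)) (entry 0 (c e)) k
         (entry i.+1 (b e)) (entry i.+1 (c e)) 0 0) (iota 0 (size s)).
have entryP i := computable_entry (computable_const i).
apply: (computableb_has (F := F)); last exact/computable_succ/entryP.
rewrite {}/F.
move: (computable_weak bP) (computable_weak cP) => {}bP {}cP.
have kP := computable_var 0; have zeroP := computable_const 0.
apply: computableb_and.
  apply: computableb_leq; last exact: entryP.
  by apply: computable_add; last exact: entryP.
apply: computableb_all_const => i.
by apply: computable_agree => //; apply: entryP.
Qed.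

Lemma computable_avoids_code y c : computable y -> computable c ->
  computable (fun e => avoids_code (y e) (c e)).
Proof.
move=> yP cP; apply: computableb_neg.
pose F j e := (iter j code_tail (y e) != 0) &&
  cons_le_code (entry j (y e)) (c e).
apply: (computableb_has (F := F) _ yP); rewrite {}/F.
move: (computable_weak yP) (computable_weak cP) => {}yP {}cP.
have jP := computable_var 0.
apply: computableb_and.
  apply: computableb_neg; apply: computableb_eq (computable_const 0).
  exact: computable_iter_tail.
by apply: computable_cons_le_code => //; exact: computable_entry.
Qed.

(** Enumeration of the codes of all structures of length N: c is the code of the
    relations chosen so far, and rs lists the arities of the others.  Codes of
    lists are built from their end, so rs has to be the reversed signature. *)
Fixpoint search (P : nat -> nat -> bool) rs N c y :=
  if rs is r :: rs' then
    has (fun a => search P rs' N (2 ^ a * c.*2.+1) y) (iota 0 (2 ^ (N ^ r)))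
  else P (2 ^ N * c.*2.+1) y.

Lemma searchP (P : nat -> nat -> bool) rs N l y :
  reflect (exists2 w, all2 (fun a r => a < 2 ^ N ^ r) w rs &
             P (CodeSeq.code (N :: catrev w l)) y)
          (search P rs N (CodeSeq.code l) y).
Proof.
elim: rs l => [|r rs IH] l /=.
  apply: (iffP idP) => [Pl|[[|] //]]; first by exists [::].
apply: (iffP hasP) => [[a]|[[|a w] //=]].
  rewrite mem_iota => /= a_lt /(IH (a :: l)) [w w_lt Pw].
  by exists (a :: w); rewrite //= a_lt.
move=> /andP [a_lt w_lt] Pw; exists a; first by rewrite mem_iota.
by apply/(IH (a :: l)); exists w.
Qed.

Lemma computable_search (P : nat -> nat -> bool) rs N c y :
  (forall a b, computable a -> computable b ->
     computable (fun e => P (a e) (b e))) ->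
  computable N -> computable c -> computable y ->
  computable (fun e => search P rs (N e) (c e) (y e)).
Proof.
move=> PP; have consP a b : computable a -> computable b ->
    computable (fun e => 2 ^ a e * (b e).*2.+1).
  move=> aP bP; apply: computable_mul.
    by apply: computable_exp => //; exact: computable_const.
  apply: computable_succ; apply: computable_ext (computable_add bP bP) _ => e.
  by rewrite addnn.
elim: rs N c y => [|r rs IH] N c y NP cP yP /=.
  by apply: PP => //; exact: consP.
pose F a e := search P rs (N e) (2 ^ a * (c e).*2.+1) (y e).
apply: (computableb_has (F := F)); last first.
  apply: computable_exp; first exact: computable_const.
  by apply: computable_exp => //; exact: computable_const.
rewrite {}/F.
move: (computable_weak NP) (computable_weak cP) => {}NP {}cP.
move: (computable_weak yP) => {}yP.
by apply: IH => //; apply: consP => //; exact: computable_var.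
Qed.

Lemma search_structureP (P : nat -> nat -> bool) N y :
  reflect (exists2 sigma : structure s,
             len sigma = N & P (code_structure sigma) y)
          (search P (rev s) N 0 y).
Proof.
pose R a r := a < 2 ^ N ^ r.
have all2_rev (w : seq nat) : all2 R w (rev s) = all2 R (rev w) s.
  rewrite !all2E !size_rev; case: eqP => //= eq_size.
  by rewrite -[w in LHS]revK -rev_zip ?size_rev // all_rev.
apply: (iffP (searchP P (rev s) N [::] y)) => [[w]|[sigma len_s Ps]].
  rewrite -[catrev w _]/(rev w) all2_rev; move: (rev w) => {}w w_ok Pw.
  have [w_size w_lt] : size w = size s /\
      forall i, i < size s -> nth 0 w i < 2 ^ N ^ nth 0 s i.
    move: w_ok; rewrite all2E => /andP [/eqP eq_size /allP zip_ok].
    split=> // i ilt.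
    have /zip_ok /= : (nth 0 w i, nth 0 s i) \in zip w s.
      by rewrite -nth_zip // mem_nth // size_zip eq_size minnn.
    by [].
  exists (Tagged (relations s) ([ffun i : 'I_(size s) =>
    [set t : (nth 0 s i).-tuple 'I_N | bit (tuple_index t) (nth 0 w i)]]
    : relations s N)) => //.
  rewrite /code_structure; congr (P (CodeSeq.code (_ :: _)) y): Pw.
  apply: (@eq_from_nth _ 0) => [|i]; first by rewrite size_map size_enum_ord.
  rewrite w_size => ilt; rewrite (nth_map (Ordinal ilt)) ?size_enum_ord //.
  rewrite (nth_ord_enum _ (Ordinal ilt)) /rels /= ffunE.
  by rewrite code_rel_onto // w_lt.
pose w := [seq code_rel (rels sigma i) | i <- enum 'I_(size s)].
exists (rev w); last by rewrite -[catrev _ _]/(rev (rev w)) revK -len_s.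
rewrite all2_rev revK all2E; apply/andP; split.
  by rewrite size_map size_enum_ord.
have size_w : size w = size s by rewrite size_map size_enum_ord.
apply/(all_nthP (0, 0)) => i; rewrite size_zip size_w minnn => ilt.
rewrite nth_zip //= (nth_map (Ordinal ilt)) ?size_enum_ord //.
by rewrite (nth_ord_enum _ (Ordinal ilt)) /R -len_s code_rel_lt.
Qed.

End Codes.

(** * The decision procedure *)

Definition count_relations s m := foldr muln 1 [seq 2 ^ m ^ r | r <- s].

Lemma card_relations s m : #|{: relations s m}| = count_relations s m.
Proof.
rewrite card_dep_ffun; congr foldr.
transitivity [seq 2 ^ m ^ nth 0 s (val i) | i <- enum 'I_(size s)].
  apply: eq_map => i; rewrite -cardsT -powersetT card_powerset cardsT.
  by rewrite card_tuple card_ord.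
rewrite (map_comp (fun i => 2 ^ m ^ nth 0 s i)) val_enum_ord.
by rewrite (map_comp (fun r => 2 ^ m ^ r) (nth 0 s)) map_nth_iota0 // take_size.
Qed.

Lemma computable_count_relations s m : computable m ->
  computable (fun e => count_relations s (m e)).
Proof.
move=> mP; elim: s => [|r s IH] /=; first exact: computable_const.
apply: computable_mul => //.
apply: computable_exp; first exact: computable_const.
by apply: computable_exp => //; exact: computable_const.
Qed.

(** Stated for every bound m on the lengths, so that m can be read off the code
    of B without decoding it. *)
Lemma bountiful_wqoP s (X : structure s -> Prop) (B : seq (structure s)) m :
  structure_type X -> bountiful X ->
  0 < m -> (forall beta, beta \in B -> len beta <= m) ->
  wqo (@cons_le s) (Av X B) <->
  ~ exists2 sigma, len sigma = count_relations s m + m & Av X B sigma.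
Proof.
move=> typeX bountX m_gt0 len_B.
split=> [[no_anti _] [sigma len_s Av_s]|no_long].
  apply: no_anti; apply: antichain_of_long m_gt0 len_B Av_s _ => //.
  by rewrite card_relations.
apply: (@wqo_of_no_long s X typeX B (count_relations s m + m).-1).
move=> sigma Av_s len_s.
by apply: no_long; exists sigma; rewrite // len_s prednK // addn_gt0 m_gt0 orbT.
Qed.

Lemma len_le_code s (beta : structure s) B :
  beta \in B -> len beta <= code_structures B.
Proof.
move=> betaB.
have /allP lt_code := CodeSeq.ltn_code (map (@code_structure s) B).
apply: leq_trans (ltnW (lt_code _ (map_f (@code_structure s) betaB))).
by have /= /andP [/ltnW] := CodeSeq.ltn_code
  (len beta :: [seq code_rel (rels beta i) | i <- enum 'I_(size s)]).
Qed.

Lemma computable_lift (d : 1.-tuple nat -> nat) a :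
  recursive d -> computable a ->
  computable (fun e => d [tuple a e]).
Proof.
move=> dP aP k; apply: recursive_ext (rec_comp dP (fun _ => aP k)) _ => x.
by congr d; apply: eq_from_tnth => i; rewrite tnth_mktuple (ord1 i).
Qed.

Theorem corollary7p4 (s : seq nat) (X : structure s -> Prop)
    (typeX : structure_type X)
    (decX : decidable_problem (@code_structure s) (fun _ => True) X)
    (bountX : bountiful X) :
  decidable_problem (@code_structures s)
    (fun B => forall beta : structure s, beta \in B -> X beta)
    (fun B => wqo (@cons_le s) (Av X B)).
Proof.
have [dX dX_rec dXP] := decX.
(* Only codes of structures are ever passed to dX, whose values elsewhere are
   arbitrary. *)
pose P c y := (dX [tuple c] == 1) && avoids_code s y c.
pose N y := count_relations s y.+1 + y.+1.
pose d y : nat := ~~ search P (rev s) (N y) 0 y.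
have d_comp : computable (fun e => d (nth 0 e 0)).
  have yP := computable_var 0; have SyP := computable_succ yP.
  apply: computableb_neg; apply: computable_search (computable_const 0) yP.
    move=> a b aP bP; apply: computableb_and.
      by apply: computableb_eq (computable_const 1); exact: computable_lift.
    exact: computable_avoids_code.
  exact: computable_add (computable_count_relations s SyP) SyP.
exists (fun x => d (nth 0 x 0)); first exact: d_comp.
move=> B BX; rewrite /d /=.
set y := code_structures B.
have len_B beta : beta \in B -> len beta <= y.+1 by move/len_le_code/leqW.
rewrite (bountiful_wqoP typeX bountX (ltn0Sn y) len_B).
have PP sigma : reflect (Av X B sigma) (P (code_structure sigma) y).
  apply: (iffP andP) =>
    [[/eqP dX1 /avoids_codeP avoid]|[Xs /avoids_codeP avoid]].
    by split=> //; apply/dXP.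
  by split=> //; apply/eqP/dXP.
case: search_structureP => [[sigma len_s /PP Av_s]|none]; split=> //.
  by case; exists sigma.
by move=> _ [sigma len_s /PP Ps]; apply: none; exists sigma.
Qed.
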